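(* Every natural reduction from 3-SAT on $n$ variables to $\mathrm{CVP}_2$ on rank-$n'$ lattices must have $n' > 4(n-2)/3$.
   Context: For a basis $B\in\mathbb{R}^{d\times n'}$ (linearly independent columns) of the lattice $\mathcal{L}=B\mathbb{Z}^{n'}$ and a target $\vec t\in\mathbb{R}^d$, let $\mathrm{CVP}(\vec t,B)=\{\vec z\in\mathbb{Z}^{n'} : \|B\vec z-\vec t\|_2 = \min_{\vec y\in\mathcal{L}}\|\vec y-\vec t\|_2\}$. A natural reduction from $k$-SAT to $\mathrm{CVP}_2$ is a (not necessarily efficient) mapping from $k$-SAT instances on $n$ variables to $\mathrm{CVP}_2$ instances $B\in\mathbb{R}^{d\times n'}$, $\vec t\in\mathbb{R}^d$ such that there exists a fixed (instance-independent, not necessarily efficiently computable) function $f:\{0,1\}^n\to\mathbb{Z}^{n'}$ with the property: if the input $k$-SAT instance is satisfiable, then $\vec x\in\{0,1\}^n$ is a satisfying assignment if and only if $f(\vec x)\in\mathrm{CVP}(\vec t,B)$. *)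

(* Defs.v *)
From HB Require Import structures.
From mathcomp Require Import all_boot all_order all_algebra.
From mathcomp Require Import boolp classical_sets reals.

Set Implicit Arguments.
Unset Strict Implicit.
Unset Printing Implicit Defensive.

Import Order.TTheory GRing.Theory Num.Theory.
Local Open Scope classical_set_scope.
Local Open Scope ring_scope.

(* The literal (i, true) is the variable x_i, and (i, false) is its negation. *)
Definition literal (n : nat) : Type := ('I_n * bool)%type.

Definition clause (n : nat) : Type := seq (literal n).

Definition assignment (n : nat) : Type := n.-tuple bool.

(* A k-clause is a disjunction of at most k literals. *)
Record ksat (k n : nat) : Type := KSat {
  clauses : seq (clause n);
  clauses_width : all (fun c : clause n => (size c <= k)%N) clauses
}.

Definition sat_literal (n : nat) (x : assignment n) (l : literal n) : bool :=
  tnth x l.1 == l.2.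

Definition sat_clause (n : nat) (x : assignment n) (c : clause n) : bool :=
  has (sat_literal x) c.

Definition satisfies (k n : nat) (x : assignment n) (phi : ksat k n) : bool :=
  all (sat_clause x) (clauses phi).

Definition satisfiable (k n : nat) (phi : ksat k n) : Prop :=
  exists x : assignment n, satisfies x phi.

(* The norm `|v| that the library puts on matrices is the sup norm. *)
Definition l2norm (R : realType) (d : nat) (v : 'cV[R]_d) : R :=
  Num.sqrt (\sum_(i < d) v i 0 ^+ 2).

Definition int_comb (R : realType) (d n' : nat) (B : 'M[R]_(d, n'))
    (z : 'cV[int]_n') : 'cV[R]_d :=
  B *m map_mx intr z.

Definition lattice (R : realType) (d n' : nat) (B : 'M[R]_(d, n')) :
    set 'cV[R]_d :=
  range (int_comb B).

Definition is_min (R : realType) (A : set R) (m : R) : Prop :=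
  A m /\ lbound A m.

Record cvp_instance (R : realType) (n' : nat) : Type := CVPInstance {
  cvp_dim : nat;
  cvp_basis : 'M[R]_(cvp_dim, n');
  cvp_target : 'cV[R]_cvp_dim;
  (* rows of the transpose, i.e. the columns of the basis, are independent *)
  cvp_basis_free : row_free cvp_basis^T
}.

Definition CVP (R : realType) (d n' : nat) (t : 'cV[R]_d) (B : 'M[R]_(d, n')) :
    set 'cV[int]_n' :=
  [set z | is_min [set l2norm (y - t) | y in lattice B]
                  (l2norm (int_comb B z - t))].

Definition natural_reduction (R : realType) (k n n' : nat)
    (red : ksat k n -> cvp_instance R n') : Prop :=
  exists f : assignment n -> 'cV[int]_n',
    forall phi : ksat k n, satisfiable phi ->
      forall x : assignment n,
        satisfies x phi <->
        CVP (cvp_target (red phi)) (cvp_basis (red phi)) (f x).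

(* Main.v *)
Require Import Defs.
From mathcomp Require Import all_boot all_order all_algebra.
From mathcomp Require Import reals.
From mathcomp Require boolp.
From mathcomp Require Import lra zify.
Import Order.TTheory GRing.Theory Num.Theory.
Local Open Scope ring_scope.

(** The squared distance [z |-> |B z - t|^2] is a quadratic polynomial in [z],
    and such polynomials form a space of dimension at most [(n' + 1)^2].  For
    a set [T] of one to three variables, let [phi_T] be the single clause
    "some variable of [T] is false".  For the instance attached to [phi_T], the
    squared distance minus its minimum vanishes at [f (1_S)] for every [S] not
    containing [T], and is nonzero at [f (1_T)].  Ordering the sets of at most
    three variables by cardinality makes the evaluation matrix triangular (the
    constant polynomial 1 serves [T = set0]), so that
    [1 + n + C(n,2) + C(n,3) <= (n' + 1)^2]. *)

(** The matrix of [a] times that of [b] factors through dimension [#|J|], yet ordered by [w] it is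
    triangular with nonzero diagonal, hence of rank [#|I|]. *)
Lemma card_le_of_triangular_eval (F : fieldType) (I J : finType)
    (a b : I -> J -> F) (w : I -> nat) :
  (forall i, \sum_j a i j * b i j != 0) ->
  (forall i k, k != i -> (w k <= w i)%N -> \sum_j a i j * b k j = 0) ->
  (#|I| <= #|J|)%N.
Proof.
move=> diag_neq0 lower_eq0.
pose A := \matrix_(i < #|I|, j < #|J|) a (enum_val i) (enum_val j).
pose B := \matrix_(j < #|J|, i < #|I|) b (enum_val i) (enum_val j).
have ABE i k : (A *m B) i k = \sum_j a (enum_val i) j * b (enum_val k) j.
  rewrite mxE (reindex _ (onW_bij _ (@enum_val_bij J))) /=.
  by apply: eq_bigr => j _; rewrite !mxE.
suff /eqP <- : row_free (A *m B).
  exact: leq_trans (mxrankM_maxl _ _) (rank_leq_col _).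
rewrite -kermx_eq0; apply/rowV0P => u.
move=> /sub_kermxP uAB0; apply/eqP/negPn/negP => /rV0Pn[i0 ui0].
(* Take [k] of least weight in the support of the kernel vector [u]: in column [k] all other terms
   vanish, leaving [u 0 k] times a nonzero diagonal entry. *)
case: (@arg_minnP _ i0 (fun i => u 0 i != 0) (fun i => w (enum_val i)) ui0).
move=> k uk min_k; have := congr1 (fun M : 'rV_#|I| => M 0 k) uAB0.
rewrite !mxE (bigD1 k) //= big1 => [|i ik].
  rewrite addr0 ABE => /eqP.
  by rewrite mulf_eq0 (negPf uk) (negPf (diag_neq0 _)).
have [->|ui] := eqVneq (u 0 i) 0; first by rewrite mul0r.
by rewrite ABE lower_eq0 ?mulr0 ?min_k // (inj_eq enum_val_inj) eq_sym.
Qed.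

Lemma card_subsets_le3 (n : nat) :
  #|[set S : {set 'I_n} | (#|S| <= 3)%N]|
    = (1 + n + 'C(n, 2) + 'C(n, 3))%N.
Proof.
rewrite -sum1_card.
(* [inord] sends cardinalities above 3 to 0; the bound on [#|S|] rules these out. *)
rewrite (partition_big (fun S : {set 'I_n} => inord #|S| : 'I_4) xpredT) //=.
transitivity (\sum_(k < 4) 'C(n, k))%N; last first.
  by rewrite !big_ord_recr big_ord0 /= bin0 bin1.
apply: eq_bigr => k _; rewrite sum1_card -[n in RHS]card_ord -card_draws.
apply: eq_card => S; rewrite !inE unfold_in inE.
apply/andP/eqP => [[S3 /eqP <-]|Sk]; first by rewrite inordK.
by rewrite Sk -ltnS ltn_ord inord_val.
Qed.

(** Homogeneous coordinates: [None] carries the constant 1, so products of two coordinates also give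
    the monomials of degree 0 and 1. *)
Definition hom_coord (R : realType) {n' : nat} (z : 'cV[int]_n')
    (j : option 'I_n') : R :=
  if j is Some i then (z i 0)%:~R else 1.

Definition monomial2 (R : realType) {n' : nat} (z : 'cV[int]_n')
    (p : option 'I_n' * option 'I_n') : R :=
  hom_coord R z p.1 * hom_coord R z p.2.

Lemma sum_mul_indicator (R : pzRingType) (J : finType) (j0 : J) (m : R)
    (F : J -> R) :
  \sum_j (if j == j0 then m else 0) * F j = m * F j0.
Proof.
rewrite (bigD1 j0) //= eqxx big1 ?addr0 // => j /negPf ->.
by rewrite mul0r.
Qed.

(** Each coordinate of [B z - t] is a linear form in the homogeneous coordinates, with [- t] as
    coefficient of [None]; expand the sum of their squares. *)
Lemma sqdist_quadratic (R : realType) (d n' : nat) (B : 'M[R]_(d, n'))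
    (t : 'cV[R]_d) (m : R) :
  exists a : option 'I_n' * option 'I_n' -> R, forall z,
    \sum_p a p * monomial2 R z p = l2norm (int_comb B z - t) ^+ 2 - m.
Proof.
pose A (i : 'I_d) (j : option 'I_n') : R :=
  if j is Some k then B i k else - t i 0.
have AE i z : \sum_j A i j * hom_coord R z j = (int_comb B z - t) i 0.
  rewrite (bigD1 None) //= (reindex_omap Some id) /=; last by case.
  rewrite mulr1 addrC !mxE; congr (_ + _).
  by apply: eq_big => k; rewrite ?eqxx // !mxE.
exists (fun p => \sum_i A i p.1 * A i p.2
                 - (if p == (None, None) then m else 0)) => z.
rewrite /l2norm sqr_sqrtr; last by apply: sumr_ge0 => i _; apply: sqr_ge0.
under eq_bigr do rewrite mulrBl.
rewrite sumrB sum_mul_indicator /monomial2 /= !mulr1; congr (_ - _).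
under eq_bigr do rewrite mulr_suml.
rewrite exchange_big; apply: eq_bigr => i _ /=.
rewrite -AE expr2 big_distrlr /= pair_bigA /=.
by apply: eq_bigr => p _; rewrite mulrACA.
Qed.

Definition indicator_assignment {n : nat} (S : {set 'I_n}) : assignment n :=
  [tuple i \in S | i < n].

Lemma some_false_width {k n : nat} {T : {set 'I_n}} :
  (#|T| <= k)%N ->
  all (fun c : clause n => (size c <= k)%N) [:: [seq (i, false) | i <- enum T]].
Proof. by move=> T_le_k; rewrite /= size_map -cardE T_le_k. Qed.

Definition some_false {k n : nat} {T : {set 'I_n}} (T_le_k : (#|T| <= k)%N) :
    ksat k n :=
  KSat (some_false_width T_le_k).

Lemma satisfies_some_false (k n : nat) (S T : {set 'I_n})
    (T_le_k : (#|T| <= k)%N) :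
  satisfies (indicator_assignment S) (some_false T_le_k) = ~~ (T \subset S).
Proof.
rewrite /satisfies /= andbT /sat_clause has_map.
apply/hasP/subsetPn => -[i]; rewrite ?mem_enum => iT.
  by rewrite /= /sat_literal /= tnth_mktuple eqbF_neg; exists i.
by move=> iS; exists i; rewrite ?mem_enum //= /sat_literal tnth_mktuple eqbF_neg.
Qed.

(** Since [f] is independent of the instance, the evaluation points are the same for all [T]; only
    the coefficients [a] vary with the basis and target. *)
Lemma separating_quadratic (R : realType) (k n n' : nat)
    (red : ksat k n -> cvp_instance R n') (f : assignment n -> 'cV[int]_n') :
  (forall phi, satisfiable phi -> forall x,
     satisfies x phi <->
     CVP (cvp_target (red phi)) (cvp_basis (red phi)) (f x)) ->
  forall T : {set 'I_n}, (#|T| <= k)%N ->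
  exists a : option 'I_n' * option 'I_n' -> R,
    \sum_p a p * monomial2 R (f (indicator_assignment T)) p != 0 /\
    forall S : {set 'I_n}, S != T -> (#|S| <= #|T|)%N ->
      \sum_p a p * monomial2 R (f (indicator_assignment S)) p = 0.
Proof.
(* For [T = set0] the clause is empty and unsatisfiable, so [redP] says nothing about it. *)
move=> redP T T_le_k; have [->|T_neq0] := eqVneq T set0.
  exists (fun p => if p == (None, None) then 1 else 0).
  split=> [|S S_neq0].
    by rewrite sum_mul_indicator /monomial2 /= !mul1r oner_neq0.
  by rewrite cards0 leqn0 cards_eq0 (negPf S_neq0).
pose phi := some_false T_le_k.
have sat0 : satisfies (indicator_assignment set0) phi.
  by rewrite satisfies_some_false subset0.
have phi_sat : satisfiable phi by exists (indicator_assignment set0).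
have CVPP := redP phi phi_sat.
set B := cvp_basis (red phi) in CVPP; set t := cvp_target (red phi) in CVPP.
pose dist S := l2norm (int_comb B (f (indicator_assignment S)) - t).
have min0 := (CVPP _).1 sat0.
have dist_ge0 S : 0 <= dist S by apply: sqrtr_ge0.
have [a aE] := sqdist_quadratic R _ _ B t (dist set0 ^+ 2).
exists a; split=> [|S S_neqT S_le_T]; rewrite aE -/(dist _).
  rewrite subr_eq0 eqrXn2 //; apply/eqP => dist_eq.
  suff : satisfies (indicator_assignment T) phi.
    by rewrite satisfies_some_false subxx.
  by apply/CVPP; rewrite /CVP /= -/(dist T) dist_eq.
have satS : satisfies (indicator_assignment S) phi.
  rewrite satisfies_some_false; apply: contra S_neqT => TS.
  by rewrite eq_sym eqEcard TS.
have minS := (CVPP _).1 satS.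
suff -> : dist S = dist set0 by rewrite subrr.
by apply/eqP; rewrite eq_le (minS.2 _ min0.1) (min0.2 _ minS.1).
Qed.

Lemma natural_reduction_rank_bound (R : realType) (n n' : nat)
    (red : ksat 3 n -> cvp_instance R n') :
  natural_reduction red ->
  (1 + n + 'C(n, 2) + 'C(n, 3) <= n'.+1 ^ 2)%N.
Proof.
case=> f /separating_quadratic sepP; rewrite -card_subsets_le3.
set X := [set S : {set 'I_n} | _].
have sep (T : {S | S \in X}) : exists a : option 'I_n' * option 'I_n' -> R,
    \sum_p a p * monomial2 R (f (indicator_assignment (val T))) p != 0 /\
    forall S : {set 'I_n}, S != val T -> (#|S| <= #|val T|)%N ->
      \sum_p a p * monomial2 R (f (indicator_assignment S)) p = 0.
  by apply: sepP; have := valP T; rewrite inE.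
have [a aP] := boolp.choice sep.
have := @card_le_of_triangular_eval R _ _ a
  (fun T => monomial2 R (f (indicator_assignment (val T))))
  (fun T => #|val T|) (fun T => (aP T).1).
rewrite card_sig card_prod card_option card_ord; apply => T S ST.
by apply: (aP T).2; rewrite (inj_eq val_inj).
Qed.

Lemma binomial_rank_arith (n n' : nat) :
  (1 + n + 'C(n, 2) + 'C(n, 3) <= n'.+1 ^ 2)%N -> (4 * n < 3 * n' + 8)%N.
Proof.
move=> bound; rewrite ltnNge; apply/negP => small.
(* Writing [n] as [m.+2] removes truncated subtraction from the falling factorials; [m - 3] below is
   then [n - 5]. *)
have [m n_eq] : exists m, n = m.+2 by exists n.-2; lia.
have C2 := bin_ffact n 2; have C3 := bin_ffact n 3.
rewrite n_eq /= in bound small C2 C3.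
rewrite !ffactnS !ffactn0 /= !muln1 in C2 C3.
have key : (6 * (1 + m.+2 + 'C(m.+2, 2) + 'C(m.+2, 3))
             = 6 + 6 * m.+2 + 3 * (m.+2 * m.+1) + m.+2 * m.+1 * m)%N.
  by move: C2 C3; rewrite !factS fact0; nia.
(* The bound fails because
   [9 (n^3 + 5 n + 6) - 6 (4 n - 5)^2 = (9 n - 6) (n - 5)^2 + 54 > 0]. *)
have := sqr_ge0 (m%:Z - 3); nia.
Qed.

Theorem theorem6p6 (R : realType) (n n' : nat)
    (red : ksat 3 n -> cvp_instance R n') :
  natural_reduction red -> 4 * (n%:R - 2) / 3 < n'%:R :> R.
Proof.
move=> /natural_reduction_rank_bound /binomial_rank_arith.
rewrite -(ltr_nat R) natrD !natrM => bound; lra.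
Qed.
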